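(* Let $n\ge 2$ and $1\le d\le n-1$, and let $$g_{n,d}(x)=\sum_{i=1}^{\min(d,n-d)}\frac{(n-i-1)!}{(d-i)!\,(n-d-i)!\,(i-1)!}\,x^i .$$ Then for all real $x$, $g_{n,d}'(x)^2-g_{n,d}(x)g_{n,d}''(x)\ge 0$.
   Context: $g_{n,d}(x)$ is Speyer's $g$-polynomial of the uniform matroid $U_{n,d}$ of rank $d$ on $n$ elements. *)

(* Defs.v *)
From mathcomp Require Import all_boot all_order all_algebra.
From mathcomp Require Import reals.
Set Implicit Arguments.
Unset Strict Implicit.
Unset Printing Implicit Defensive.
Import Order.TTheory GRing.Theory Num.Theory.
Local Open Scope ring_scope.

(* Since 1 <= i <= min(d, n - d), none of the nat subtractions truncates as
   soon as 1 <= d <= n - 1. *)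
Definition gpoly (R : realType) (n d : nat) : {poly R} :=
  \sum_(1 <= i < (minn d (n - d)).+1)
    ((n - i - 1)`!%:R
       / ((d - i)`!%:R * (n - d - i)`!%:R * (i - 1)`!%:R)) *: 'X^i.

(* Main.v *)
Require Import Defs.
From mathcomp Require Import all_boot all_order all_algebra.
From mathcomp Require Import reals.
From mathcomp Require Import ring zify complex.
Import Order.TTheory GRing.Theory Num.Theory.
Local Open Scope ring_scope.

(** Put [a = d - 1] and [b = n - d - 1].  Up to the factor [a!], the polynomial
    [g] is [z ^ (b + 1) * Q (1 / z)] with [Q] the [a]-th derivative of
    [X ^ b * (X + 1) ^ a].  By the Gauss-Lucas argument differentiation
    preserves real-rootedness, so [Q], and hence [g], has only real roots.
    For a product [p] of real linear factors, [p' ^ 2 - p * p''] is a sum of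
    squares. *)

Section RealRooted.
Variable C : numClosedFieldType.
Implicit Types (p : {poly C}) (s : seq C) (x z c : C).

(** The scalar may be [0], so the zero polynomial counts as real-rooted; this keeps the notion
    stable under differentiation. *)
Definition real_rooted p :=
  exists2 cs : C * seq C, {subset cs.2 <= Num.real}
    & p = cs.1 *: \prod_(r <- cs.2) ('X - r%:P).

Lemma real_rootedP p :
  (p != 0 -> forall z, root p z -> z \is Num.real) <-> real_rooted p.
Proof.
split=> [realp | [[c s] /= sreal ->]].
  have [->|p0] := eqVneq p 0; first by exists (0, [::]); rewrite ?scale0r.
  have [s ps] := closed_field_poly_normal p.
  exists (lead_coef p, s) => //= z zs; apply: realp => //.
  by rewrite ps rootZ ?lead_coef_eq0// root_prod_XsubC.
have [->|c0 _ z] := eqVneq c 0; first by rewrite scale0r eqxx.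
by rewrite rootZ// root_prod_XsubC => /sreal.
Qed.

(* [p' / p] is the sum of the [1 / (z - r)], whose imaginary parts all have the
   sign opposite to that of ['Im z]; multiplying by [`|p| ^ 2] avoids division. *)
Lemma Im_deriv_conj_prod_XsubC s z (p := \prod_(r <- s) ('X - r%:P)) :
  {subset s <= Num.real} -> 'Im z != 0 ->
  'Im z * 'Im (p^`().[z] * (p.[z])^*) <= 0
    ?= iff (s == [::]).
Proof.
rewrite /p => {p} + z0; elim: s => [_|r s IHs rs].
  by rewrite big_nil derivC horner0 mul0r raddf0 mulr0; split; rewrite ?eqxx.
have rr : r \is Num.real by apply: rs; rewrite inE eqxx.
have {}IHs := IHs (fun t ts => rs t (mem_behead (s := r :: s) ts)).
rewrite big_cons; set p := \prod_(_ <- _) _ in IHs *.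
have pz : p.[z] != 0.
  apply/negP => /eqP /rootP; rewrite root_prod_XsubC => zs.
  move: z0; rewrite (Creal_ImP z _) ?eqxx//.
  by apply: rs; rewrite inE zs orbT.
rewrite derivM derivXsubC mul1r !hornerE rmorphM /=.
rewrite [X in _ * 'Im X](_ : _ = `|p.[z]| ^+ 2 * (z - r)^*
                 + `|z - r| ^+ 2 * (p^`().[z] * (p.[z])^*)); last first.
  by rewrite !normCK; ring.
have realn (w : C) : `|w| ^+ 2 \is Num.real by rewrite rpredX// normr_real.
rewrite raddfD /= ImMl// ImMl// Im_conj raddfB /= (Creal_ImP r rr) subr0.
(* A nonempty list calls for a strict inequality. The term of the new root [r] supplies it, so the
   induction hypothesis enters only in its weak form. *)
apply/leifP; rewrite /= mulrDr.
have lt0 : 'Im z * (`|p.[z]| ^+ 2 * - 'Im z) < 0.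
  rewrite mulrCA mulrN mulrN oppr_lt0 mulr_gt0 ?exprn_gt0 ?normr_gt0//.
  rewrite -expr2 -real_normK ?Creal_Im// exprn_gt0 ?normr_gt0//.
rewrite -[ltRHS]addr0 ltr_leD// mulrCA mulr_ge0_le0 ?exprn_ge0//.
exact: IHs.1.
Qed.

(** A nonreal zero of the derivative would give equality in the previous lemma, so there would be no
    roots at all and the derivative would vanish identically. *)
Lemma real_rooted_deriv p : real_rooted p -> real_rooted p^`().
Proof.
case=> [[c s] /= sreal ->]; apply/real_rootedP.
rewrite derivZ => p0 z; move: p0.
rewrite scaler_eq0 negb_or => /andP[c0 p0]; rewrite rootZ// => /rootP pz.
apply/Creal_ImP/eqP; case: eqP => // /eqP Iz.
have := Im_deriv_conj_prod_XsubC _ _ sreal Iz.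
rewrite pz mul0r raddf0 mulr0 => -[_]; rewrite eqxx => /esym/eqP s0.
by move: p0; rewrite s0 big_nil derivC eqxx.
Qed.

Lemma real_rooted_derivn p k : real_rooted p -> real_rooted p^`(k).
Proof.
by move=> rp; elim: k => [|k IHk]; rewrite ?derivn0// derivnS; apply: real_rooted_deriv.
Qed.

(** Write L(p) for p'^2 - p p''. Then L((X - r) p) = p^2 + (x - r)^2 L(p) at [x], and induction
    applies; the value of [p] must be tracked as real for its square to be nonnegative in [C]. *)
Lemma laguerre_prod_XsubC s x (p := \prod_(r <- s) ('X - r%:P)) :
  {subset s <= Num.real} -> x \is Num.real ->
  p.[x] \is Num.real /\ 0 <= p^`().[x] ^+ 2 - p.[x] * p^`(2).[x].
Proof.
rewrite /p => {p} + rx; elim: s => [_|r s IHs rs].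
  by rewrite big_nil !(derivSn, derivn0, derivC, hornerE) expr0n /= subr0 rpred1.
have rr : r \is Num.real by apply: rs; rewrite inE eqxx.
have [] := IHs (fun t ts => rs t (mem_behead (s := r :: s) ts)).
rewrite big_cons; set p := \prod_(_ <- _) _ => rp Lp.
split; first by rewrite !hornerE rpredM ?rpredB.
rewrite !derivnS derivn0 in Lp *.
rewrite derivM derivXsubC mul1r derivD derivM derivXsubC mul1r !hornerE /=.
rewrite (_ : _ - _ = p.[x] ^+ 2
   + (x - r) ^+ 2 * (p^`().[x] ^+ 2 - p.[x] * p^`()^`().[x])); last by ring.
have sqr_real_ge0 (y : C) : y \is Num.real -> 0 <= y ^+ 2.
  by move=> ry; rewrite real_exprn_even_ge0.
by rewrite addr_ge0 ?sqr_real_ge0// mulr_ge0// sqr_real_ge0// rpredB.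
Qed.

Lemma laguerre_real_rooted p x :
  real_rooted p -> lead_coef p \is Num.real -> x \is Num.real ->
  0 <= p^`().[x] ^+ 2 - p.[x] * p^`(2).[x].
Proof.
case=> [[c s] /= sreal ->].
rewrite lead_coefZ (monicP (monic_prod_XsubC _ _ _)) mulr1 => rc rx.
have [_ L] := laguerre_prod_XsubC _ _ sreal rx.
rewrite !derivnS derivn0 in L *; rewrite !derivZ !hornerZ.
move: L; set L := (X in 0 <= X) => L0.
rewrite [X in 0 <= X](_ : _ = c ^+ 2 * L); last by rewrite /L; ring.
by rewrite mulr_ge0// real_exprn_even_ge0.
Qed.

End RealRooted.

Section Rodrigues.
Variables (F : fieldType) (a b : nat).

(** Rodrigues' formula: for a = b this is a! times the Legendre polynomial of degree a at 2X + 1. *)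
Definition rodrigues_poly : {poly F} := ('X^b * ('X + 1) ^+ a)^`(a).

Lemma horner_rodrigues_poly (w : F) :
  rodrigues_poly.[w] =
    \sum_(m < a.+1) ('C(a, m) * (a + b - m) ^_ a)%:R * w ^+ (b - m).
Proof.
rewrite /rodrigues_poly exprDn mulr_sumr raddf_sum horner_sum.
apply: eq_bigr => -[m /= /ltnSE ma] _.
rewrite expr1n mulr1 mulrnAr -exprD derivnMn derivnXn !hornerMn hornerXn.
rewrite (_ : b + (a - m) = a + b - m)%N; last by lia.
(* For m > b the exponent [b - m] truncates, but then a + b - m < a and the falling factorial is
   zero. *)
have [mb|bm] := leqP m b; last by rewrite !ffact_small ?muln0 ?mulr0n ?mul0rn ?mul0r//; lia.
rewrite (_ : a + b - m - a = b - m)%N; last by lia.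
by rewrite -mulrnA mulnC mulr_natl.
Qed.

End Rodrigues.

Lemma real_rooted_rodrigues_poly (C : numClosedFieldType) (a b : nat) :
  real_rooted C (rodrigues_poly C a b).
Proof.
apply: real_rooted_derivn; apply/real_rootedP => _ z.
rewrite rootM => /orP[] /rootP; rewrite !hornerE => /eqP.
  by rewrite expf_eq0 => /andP[_ /eqP->]; rewrite real0.
by rewrite expf_eq0 addr_eq0 => /andP[_ /eqP->]; rewrite realN real1.
Qed.

(** With denominators cleared, this says that the coefficient in the Rodrigues sum is a! times the
    coefficient of x^(m+1) in g. *)
Lemma rodrigues_coef (a b m : nat) : (m <= a)%N -> (m <= b)%N ->
  ('C(a, m) * (a + b - m) ^_ a * ((a - m)`! * (b - m)`! * m`!) =
   a`! * (a + b - m)`!)%N.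
Proof.
move=> ma mb; rewrite -(bin_fact ma).
have le : (a <= a + b - m)%N by lia.
rewrite -(ffact_fact le) (_ : a + b - m - a = b - m)%N; last by lia.
by ring.
Qed.

Lemma horner_gpoly (R : realType) (F : numFieldType) (f : {rmorphism R -> F})
    (a b : nat) (z : F) : z != 0 ->
  a`!%:R * (map_poly f (gpoly R (a + b).+2 a.+1)).[z]
  = z ^+ b.+1 * (rodrigues_poly F a b).[z^-1].
Proof.
move=> z0; rewrite horner_rodrigues_poly /gpoly raddf_sum horner_sum !mulr_sumr.
rewrite (_ : (a + b).+2 - a.+1 = b.+1)%N; last by lia.
rewrite minnSS big_add1 /=.
rewrite -(big_mkord predT (fun m => z ^+ b.+1 *
  (('C(a, m) * (a + b - m) ^_ a)%:R * z^-1 ^+ (b - m)))).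
(* The sum for g stops at m = min(a, b); the remaining Rodrigues terms, with b < m <= a, have a zero
   falling factorial. *)
rewrite [RHS](@big_cat_nat _ _ _ (minn a b).+1) ?ltnS ?geq_minl//=.
rewrite [X in _ = _ + X]big_nat_cond [X in _ = _ + X]big1 ?addr0; last first.
  move=> m /andP[/andP[+ _] _]; rewrite gtn_min => /orP[am|bm].
    by rewrite bin_small// mul0n mul0r mulr0.
  by have [am|ma] := ltnP a m; [rewrite bin_small ?mul0n | rewrite ffact_small ?muln0 ?mul0r ?mulr0//; lia]; rewrite ?mul0r ?mulr0.
rewrite !big_nat; apply: eq_bigr => m /=; rewrite ltnS leq_min => /andP[ma mb].
rewrite map_polyZ map_polyXn hornerZ hornerXn.
rewrite !subSS subn1 subn0 /= rmorphM fmorphV !rmorphM !rmorph_nat /=.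
rewrite (_ : ((a + b).+1 - m).-1 = a + b - m)%N; last by lia.
have fact0 k : k`!%:R != 0 :> F by rewrite pnatr_eq0 -lt0n fact_gt0.
have zE : z ^+ b.+1 * z^-1 ^+ (b - m) = z ^+ m.+1.
  rewrite (_ : b.+1 = m.+1 + (b - m))%N; last by lia.
  by rewrite exprD exprVn mulfK// expf_neq0.
rewrite [RHS]mulrCA zE mulrA; congr (_ * _); rewrite mulrA.
apply/(canLR (mulfK _)); first by rewrite !mulf_neq0.
by rewrite -!natrM -rodrigues_coef.
Qed.

Lemma real_rooted_gpoly (R : realType) (C : numClosedFieldType)
    (f : {rmorphism R -> C}) (a b : nat) :
  real_rooted C (map_poly f (gpoly R (a + b).+2 a.+1)).
Proof.
apply/real_rootedP => _ z /rootP gz.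
have [->|z0] := eqVneq z 0; first exact: real0.
have := horner_gpoly _ _ f a b _ z0; rewrite gz mulr0 => /esym/eqP.
rewrite mulf_eq0 expf_eq0 (negPf z0) andbF /= => rz.
rewrite -realV; have /real_rootedP := real_rooted_rodrigues_poly C a b.
(* Q is nonzero: its value at 1 is a sum of natural numbers whose term m = 0 is [(a + b) ^_ a],
   which is positive. *)
apply => //; apply/negP => /eqP Q0.
have /eqP := horner_rodrigues_poly C a b 1.
rewrite Q0 horner0; under eq_bigr do rewrite expr1n mulr1.
rewrite -natr_sum eq_sym pnatr_eq0 sum_nat_eq0 => /forallP/(_ ord0)/=.
by rewrite bin0 mul1n subn0 -leqn0 leqNgt ffact_gt0 leq_addr.
Qed.

Theorem theorem8p2 (R : realType) (n d : nat)
  (hn : (2 <= n)%N) (hd1 : (1 <= d)%N) (hdn : (d <= n - 1)%N) (x : R) :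
  0 <= (gpoly R n d)^`().[x] ^+ 2
       - (gpoly R n d).[x] * (gpoly R n d)^`(2).[x].
Proof.
have -> : n = (d.-1 + (n - d.+1)).+2 by lia.
rewrite -(prednK hd1) /=; move: d.-1 (n - _)%N => a b.
(* The embedding of [R] into its complex numbers reflects the order, so the inequality can be proved
   where g splits into linear factors. *)
have realC (y : R) : (y%:C)%C \is Num.real by apply/complex_realP; exists y.
rewrite -ler0c rmorphB rmorphXn rmorphM /= -!horner_map /= -!deriv_map.
apply: laguerre_real_rooted; first exact: real_rooted_gpoly.
  by rewrite lead_coef_map; apply: realC.
exact: realC.
Qed.
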